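(* Let $q=3^k$ with $k\ge2$, and set $d_q:=\frac{q-4}{3q-4}$. Define $w_q:\{0,\ldots,q-1\}\to\mathbb{R}$ by $w_q(0)=d_q$ and, for $a\ne0$, $$w_q(a)=\frac{3q}{k(3q-4)}s_3(a)-\frac{3q+4}{3q-4}.$$ Then $$\sum_{a=0}^{q-1}w_q(a)=0,\qquad\lVert w_q\rVert_\infty=1,$$ and $$w_q(u)+w_q(v)+w_q(w)\ge3d_q\qquad\text{for all }(u,v,w)\in\Gamma_q.$$ Moreover, the ratio $d_q$ is optimal in the following sense: if $w_1,w_2,w_3:\{0,\dots,q-1\}\to\mathbb{R}$ and $\eta>0$ satisfy $\sum_{a=0}^{q-1}w_i(a)=0$ for $i=1,2,3$ and $w_1(\alpha_1)+w_2(\alpha_2)+w_3(\alpha_3)\ge\eta$ for every $\alpha\in\Gamma_q$, and $W=\sum_{i=1}^3\lVert w_i\rVert_\infty$, then $$\frac{\eta}{W}\le d_q.$$ Consequently, $$H(\Gamma_q)\le\log q-\frac{d_q^2}{2},\qquad\exp\bigl(H(\Gamma_q)\bigr)\le q\exp\!\left(-\frac{d_q^2}{2}\right)<q.$$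
   Context: For an integer $a\in\{0,\dots,3^k-1\}$ with ternary expansion $a=\sum_{j=0}^{k-1}a_j3^j$, $a_j\in\{0,1,2\}$, put $s_3(a)=\sum_{j=0}^{k-1}a_j$. Let $\tau_q(x,y,z)=1-(xy+yz+zx)^{q-1}$, a polynomial over $\mathbb{F}_q$, $q=3^k$; every variable occurs in it with exponent at most $q-1$. $\Gamma_q\subseteq\{0,\dots,q-1\}^3$ is its support in the monomial basis, i.e. the set of exponent triples $(u,v,w)$ such that $x^uy^vz^w$ has nonzero coefficient (in characteristic three) in $\tau_q$. $\lVert w\rVert_\infty=\max_a|w(a)|$. Logarithms are natural; for a probability distribution $\mu$ on a finite set $H(\mu)=-\sum_x\mu(x)\log\mu(x)$ (with $0\log 0=0$), and for nonempty $\Gamma\subseteq\{0,\dots,q-1\}^3$, $H(\Gamma)=\max_\mu\min_{1\le i\le3}H(\mu_i)$, where $\mu$ ranges over probability distributions on $\Gamma$ and $\mu_i$ is its $i$-th marginal. *)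

(* Defs.v *)
From HB Require Import structures.
From mathcomp Require Import all_boot all_order all_algebra.
From mathcomp Require mpoly.
From mathcomp Require Import boolp classical_sets reals sequences exp.

Set Implicit Arguments.
Unset Strict Implicit.
Unset Printing Implicit Defensive.

Import Order.TTheory GRing.Theory Num.Theory.

Local Open Scope ring_scope.

Definition s3 (k a : nat) : nat := (\sum_(j < k) (a %/ 3 ^ j) %% 3)%N.

Notation triple q := {ffun 'I_3 -> 'I_q}.

(* mpoly is imported inside a module only, because some of its notations clash
   with those of MathComp-Analysis. *)
Module Tau.
Import mpoly.

Section Tau.
Variables (F : finFieldType) (q : nat).

Definition tau : {mpoly F[3]} :=
  let x : {mpoly F[3]} := 'X_(inord 0) in
  let y : {mpoly F[3]} := 'X_(inord 1) in
  let z : {mpoly F[3]} := 'X_(inord 2) in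
  1 - (x * y + y * z + z * x) ^+ (q - 1).

Definition Gamma : {set triple q} :=
  [set g : triple q | tau@_[multinom (g i : nat) | i < 3] != 0].

(* Restricting to exponents below q, as the type of Gamma does, loses no
   monomial of tau. *)
Lemma Gamma_full (m : 'X_{1..3}) : (0 < q)%N -> tau@_m != 0 ->
  exists2 g : triple q, g \in Gamma & forall i, g i = m i :> nat.
Proof.
move=> q_gt0 tau_m.
set e : {mpoly F[3]} :=
  'X_(inord 0) * 'X_(inord 1) + 'X_(inord 1) * 'X_(inord 2)
  + 'X_(inord 2) * 'X_(inord 0).
have e_le (m' : 'X_{1..3}) i : e@_m' != 0 -> (m' i <= 1)%N.
  rewrite /e -!mpolyXD !mcoeffD !mcoeffX.
  have bnd (a b : nat) : (a < 3)%N -> (b < 3)%N -> a != b ->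
      (U_(inord a : 'I_3) + U_(inord b : 'I_3))%MM == m' -> (m' i <= 1)%N.
    move=> a3 b3 ab /eqP <-; rewrite mnmDE !mnm1E.
    have [ai|_] := eqVneq (inord a) i; last by case: eqP.
    have [bi|//] := eqVneq (inord b) i.
    by case/eqP: ab; rewrite -(inordK a3) -(inordK b3) ai bi.
  have [/(bnd 0 1)%N-> //|_] := boolP ((U_(inord 0) + U_(inord 1))%MM == m').
  have [/(bnd 1 2)%N-> //|_] := boolP ((U_(inord 1) + U_(inord 2))%MM == m').
  have [/(bnd 2 0)%N-> //|_] := boolP ((U_(inord 2) + U_(inord 0))%MM == m').
  by rewrite !addr0 eqxx.
have pow_le n (m' : 'X_{1..3}) i : (e ^+ n)@_m' != 0 -> (m' i <= n)%N.
  rewrite -mcoeff_msupp; elim: n m' => [|n IHn] m'.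
    by rewrite expr0 msupp1 inE => /eqP ->; rewrite mnmE.
  rewrite exprS => /msuppM_le /allpairsP[[m1 m2] /= [m1e m2e ->]].
  by rewrite mnmDE; apply: (@leq_add _ _ 1 n); rewrite ?IHn // e_le // -mcoeff_msupp.
have m_lt i : (m i < q)%N.
  have [|] := boolP ((e ^+ (q - 1))@_m == 0).
    move=> /eqP e0; move: tau_m; rewrite /tau -/e mcoeffB e0 subr0 mcoeff1.
    by have [->|_] := eqVneq m 0%MM; rewrite ?mnmE ?eqxx.
  by move/(pow_le _ _ i)/leq_ltn_trans; apply; rewrite ltn_subrL q_gt0.
have mE : [multinom ([ffun i => Ordinal (m_lt i)] i : nat) | i < 3] = m.
  by apply/mnmP => i; rewrite mnmE ffunE.
exists [ffun i => Ordinal (m_lt i)]; last by move=> i; rewrite ffunE.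
by rewrite inE mE.
Qed.

End Tau.
End Tau.
Notation Gamma := Tau.Gamma.

Section Entropy.
Variable R : realType.

Definition sup_norm (q : nat) (w : 'I_q -> R) : R :=
  \big[Num.max/0]_(a < q) `|w a|.

Definition entropy (T : finType) (p : T -> R) : R :=
  - \sum_x p x * ln (p x).

Definition distr_on (T : finType) (A : {set T}) (mu : T -> R) : Prop :=
  [/\ forall x, 0 <= mu x, forall x, x \notin A -> mu x = 0
    & \sum_x mu x = 1].

Definition marginal (q : nat) (mu : triple q -> R) (i : 'I_3) (a : 'I_q) : R :=
  \sum_(g : triple q | g i == a) mu g.

(* The index of the bigop starts from the value at i = 0, so this is the plain
   minimum over the three marginals. *)
Definition min_entropy (q : nat) (mu : triple q -> R) : R :=
  \big[Num.min/entropy (marginal mu ord0)]_(i < 3) entropy (marginal mu i).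

(* By compactness the supremum is a maximum when A is nonempty. *)
Definition set_entropy (q : nat) (A : {set triple q}) : R :=
  sup [set min_entropy mu | mu in [set mu | distr_on A mu]]%classic.

Definition dq (q : nat) : R := (q%:R - 4) / (3 * q%:R - 4).

Definition wq (k q : nat) (a : 'I_q) : R :=
  if a == 0 :> nat then dq q
  else 3 * q%:R / (k%:R * (3 * q%:R - 4)) * (s3 k a)%:R
       - (3 * q%:R + 4) / (3 * q%:R - 4).

End Entropy.

(* Main.v *)
Require Import Defs.
From mathcomp Require Import all_boot all_order all_algebra all_field.
From mathcomp Require Import zify ring lra.
From mathcomp Require mpoly.
From mathcomp Require Import boolp classical_sets reals sequences exp.

Set Implicit Arguments.
Unset Strict Implicit.
Unset Printing Implicit Defensive.

Import Order.TTheory GRing.Theory Num.Theory.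

Local Open Scope ring_scope.

(** Write e = xy + yz + zx and q = 3 ^ k.

    Support.  In characteristic three e ^ (3 ^ k - 1) is the product of the
    Frobenius twists of e ^ 2, one for each ternary digit, so the coefficient
    of a monomial of e ^ (q - 1) is, up to cubing, the product over the digit
    positions of coefficients of e ^ 2 ([mcoeff_esym2S]).  As e ^ 2 involves
    exactly the exponents at most 2 with sum 4, every nonzero element of Gamma_q
    has digit sums adding up to 4k ([Gamma_digit_sum]); conversely, for every v,
    the triple (q - 1, v, q - 1 - v) and its cyclic shifts lie in Gamma_q
    ([Gamma_compl]), because the digits of q - 1 are all 2 and v, q - 1 - v have
    complementary digits.

    The weight.  Off zero w_q is an increasing affine function of the digit
    sum, and it is at least that affine function at zero.  On triples of total
    digit sum 4k the affine function adds up to exactly 3 d_q, and on (0, 0, 0)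
    w_q does so by definition.  The pairing of a with q - 1 - a gives the
    average digit sum k, whence the mean value zero; the extreme value 1 is
    attained at q - 1.

    Optimality.  This is linear programming duality ([eta_le_sup_norm]): sum the
    constraint over (0, 0, 0) with multiplicity 2 and over the 3 (q - 2) cyclic
    shifts of (q - 1, v, q - 1 - v) with 0 < v < q - 1.  Every value other than
    q - 1 is then used exactly twice in each coordinate, and q - 1 is used
    q - 2 times; subtracting twice the vanishing sums leaves
    (3q - 4) eta <= (q - 4) (w_1(q - 1) + w_2(q - 1) + w_3(q - 1)).

    Entropy.  For a distribution on Gamma_q, one of the three marginals p
    satisfies sum_a p(a) w_q(a) >= d_q, while the uniform distribution gives w_q
    the mean 0.  By the Gibbs variational principle, with Hoeffding's bound
    on the exponential moments of w_q, such a bias d costs at least d ^ 2 / 2 of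
    entropy ([entropy_le_bias]). *)

(** * Ternary digit sums *)

Section DigitSum.
Local Open Scope nat_scope.

Lemma s3S k a : s3 k.+1 a = a %% 3 + s3 k (a %/ 3).
Proof.
rewrite /s3 big_ord_recl expn0 divn1; congr addn.
by apply: eq_bigr => j _; rewrite /= /bump expnS divnMA.
Qed.

Lemma s3_0 k : s3 k 0 = 0.
Proof. by rewrite /s3 big1 // => j _; rewrite div0n. Qed.

(** No borrow occurs when a is subtracted from 3 ^ k - 1, all of whose digits
    are 2, so the digits of a are complemented to 2 one by one. *)
Lemma s3_compl k a : a < 3 ^ k -> s3 k a + s3 k (3 ^ k - a.+1) = k.*2.
Proof.
elim: k a => [|k IHk] a; first by rewrite /s3 !big_ord0.
rewrite !s3S expnS => a_lt.
have -> : (3 * 3 ^ k - a.+1) %% 3 = 2 - a %% 3 by lia.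
have -> : (3 * 3 ^ k - a.+1) %/ 3 = 3 ^ k - (a %/ 3).+1 by lia.
have := IHk (a %/ 3) ltac:(lia); lia.
Qed.

Lemma s3_gt0 k a : 0 < a < 3 ^ k -> 0 < s3 k a.
Proof.
elim: k a => [|k IHk] a; first by rewrite expn0; lia.
rewrite s3S expnS => a_lt; have := IHk (a %/ 3); lia.
Qed.

Lemma s3_max k : s3 k (3 ^ k - 1) = k.*2.
Proof. by rewrite -(@s3_compl k 0) ?s3_0 // expn_gt0. Qed.

Lemma sum_s3 k : \sum_(a < 3 ^ k) s3 k a = k * 3 ^ k.
Proof.
apply: double_inj; rewrite -addnn {2}(reindex_inj rev_ord_inj) -big_split /=.
under eq_bigr => a _ do rewrite s3_compl //.
by rewrite sum_nat_const card_ord -!muln2; lia.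
Qed.

End DigitSum.

(** * The support of tau *)

Module Support.
Import mpoly.

Section Lucas.
Variables (F : comNzRingType) (n p : nat).
Hypothesis charFp : p \in [pchar F].

Lemma mpoly_frobenius (f : {mpoly F[n]}) :
  f ^+ p = \sum_(m <- msupp f) (f@_m ^+ p) *: 'X_[(m *+ p)%MM].
Proof.
have charP : p \in [pchar {mpoly F[n]}].
  rewrite inE (pcharf_prime charFp) /=.
  by rewrite -mpolyC_nat (pcharf0 charFp) mpolyC0.
rewrite {1}[f]mpolyE.
rewrite -(pFrobenius_autE charP).
elim/big_rec2: _ => [|m x y _ <-]; first by rewrite pFrobenius_aut0.
rewrite pFrobenius_autD_comm; last exact: mulrC.
by rewrite !pFrobenius_autE exprZn mpolyXn.
Qed.

(** The monomials of f ^ p have all exponents divisible by p and those of g have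
    exponents below p, so Euclidean division by p of the exponents singles out
    one pair of monomials: a polynomial form of Lucas' theorem. *)
Lemma mcoeff_lucas (f g : {mpoly F[n]}) (m t : 'X_{1..n}) :
  (forall u, g@_u != 0 -> forall i, (u i < p)%N) -> (forall i, (t i < p)%N) ->
  (f ^+ p * g)@_(m *+ p + t) = f@_m ^+ p * g@_t.
Proof.
move=> g_lt t_lt.
have p_gt0 : (0 < p)%N by apply/prime_gt0/(pcharf_prime charFp).
have XgE u : ('X_[(u *+ p)%MM] * g)@_(m *+ p + t) = if u == m then g@_t else 0.
  rewrite mulrC; have [->|um] := eqVneq; first by rewrite mcoeffMX.
  apply/eqP; rewrite mcoeff_eq0 (perm_mem (msuppMX _ _)).
  apply: contra um => /mapP[v]; rewrite mcoeff_msupp => /g_lt v_lt /mnmP muE.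
  apply/eqP/mnmP => i; move: (muE i) => /(congr1 (divn^~ p)).
  rewrite !mnmDE !mulmnE !divnMDl // !divn_small ?addn0 //.
rewrite mpoly_frobenius mulr_suml raddf_sum /=.
under eq_bigr => u _ do rewrite -scalerAl mcoeffZ XgE.
have [mf|mf] := boolP (m \in msupp f).
  rewrite (bigD1_seq m) ?msupp_uniq //= eqxx big1 ?addr0 // => u /negPf ->.
  exact: mulr0.
rewrite big_seq big1 => [|u uf]; last first.
  by rewrite ifN ?mulr0 //; apply: contraNneq mf => <-.
by rewrite (memN_msupp_eq0 mf) expr0n eqn0Ngt p_gt0 mul0r.
Qed.

End Lucas.

Section Gamma.
Variables (F : finFieldType).

Let esym2 : {mpoly F[3]} :=
  'X_(inord 0) * 'X_(inord 1) + 'X_(inord 1) * 'X_(inord 2)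
  + 'X_(inord 2) * 'X_(inord 0).

Lemma ord3_ind (P : 'I_3 -> Prop) :
  P (inord 0) -> P (inord 1) -> P (inord 2) -> forall i, P i.
Proof.
move=> P0 P1 P2 i; rewrite -[i]inord_val.
by case: i => [[|[|[|i]]]].
Qed.

Lemma eq_mnm3 (m m' : 'X_{1..3}) :
  (m == m') = [&& m (inord 0) == m' (inord 0), m (inord 1) == m' (inord 1)
                & m (inord 2) == m' (inord 2)].
Proof.
apply/eqP/and3P => [->|[/eqP m0 /eqP m1 /eqP m2]]; first by split.
by apply/mnmP; apply: ord3_ind.
Qed.

Hypothesis char3 : 3%N \in [pchar F].

(** The coefficients of e ^ 2 are 1 at the squares and 2 at the mixed products;
    neither vanishes in characteristic three. *)
Lemma esym2_sqr_support (m : 'X_{1..3}) :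
  ((esym2 ^+ 2)@_m != 0) =
  ((m (inord 0), m (inord 1), m (inord 2)) \in
    [:: (2, 2, 0); (0, 2, 2); (2, 0, 2); (2, 1, 1); (1, 2, 1); (1, 1, 2)]%N).
Proof.
have n2 : (1 + 1 : F) != 0.
  apply/eqP => n2; have := pcharf0 char3.
  rewrite -[3%N]/(1 + 1 + 1)%N !natrD n2.
  by rewrite add0r => /eqP; rewrite oner_eq0.
have i01 : (inord 0 == inord 1 :> 'I_3) = false by rewrite -val_eqE /= !inordK.
have i02 : (inord 0 == inord 2 :> 'I_3) = false by rewrite -val_eqE /= !inordK.
have i12 : (inord 1 == inord 2 :> 'I_3) = false by rewrite -val_eqE /= !inordK.
set x : {mpoly F[3]} := 'X_(inord 0); set y : {mpoly F[3]} := 'X_(inord 1).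
set z : {mpoly F[3]} := 'X_(inord 2).
have monE a b c : (x ^+ a * y ^+ b * z ^+ c)@_m =
    ((m (inord 0), m (inord 1), m (inord 2)) == (a, b, c))%:R.
  rewrite !mpolyXn -!mpolyXD mcoeffX eq_mnm3 !mnmDE !mulmnE !mnm1E !eqxx.
  rewrite i01 i02 i12 -![inord _ == inord 0]eq_sym -[inord 2 == _]eq_sym.
  rewrite i01 i02 i12 /= !(mul0n, mul1n, addn0, add0n).
  by rewrite !xpair_eqE -andbA ![_ == m _]eq_sym.
have -> : esym2 ^+ 2 = x ^+ 2 * y ^+ 2 * z ^+ 0 + x ^+ 0 * y ^+ 2 * z ^+ 2
    + x ^+ 2 * y ^+ 0 * z ^+ 2 + (x ^+ 2 * y ^+ 1 * z ^+ 1
      + x ^+ 1 * y ^+ 2 * z ^+ 1 + x ^+ 1 * y ^+ 1 * z ^+ 2) *+ 2.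
  by rewrite /esym2 -/x -/y -/z; ring.
rewrite !(mcoeffD, mcoeffMn) !monE !inE.
move: (m _) (m _) (m _) => a b c.
case: a => [|[|[|a]]]; case: b => [|[|[|b]]]; case: c => [|[|[|c]]] //=;
  by rewrite ?(addr0, add0r) ?eqxx ?oner_eq0 //.
Qed.

Definition mnm_quo3 (m : 'X_{1..3}) : 'X_{1..3} :=
  [multinom (m i %/ 3)%N | i < 3].

Definition mnm_rem3 (m : 'X_{1..3}) : 'X_{1..3} :=
  [multinom (m i %% 3)%N | i < 3].

(** Since 3 ^ k.+1 - 1 = 3 (3 ^ k - 1) + 2, passing from k to k + 1 splits off
    the lowest ternary digit of each exponent. *)
Lemma mcoeff_esym2S k (m : 'X_{1..3}) :
  (esym2 ^+ (3 ^ k.+1 - 1))@_m =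
  (esym2 ^+ (3 ^ k - 1))@_(mnm_quo3 m) ^+ 3
    * (esym2 ^+ 2)@_(mnm_rem3 m).
Proof.
have -> : (3 ^ k.+1 - 1 = (3 ^ k - 1) * 3 + 2)%N.
  by have := expn_gt0 3 k; rewrite expnS; lia.
have {1}-> : m = (mnm_quo3 m *+ 3 + mnm_rem3 m)%MM.
  by apply/mnmP => i; rewrite mnmDE mulmnE !mnmE -divn_eq.
rewrite exprD exprM mcoeff_lucas // => [u|i]; last by rewrite mnmE ltn_mod.
rewrite esym2_sqr_support => uE i; move: i uE; apply: ord3_ind;
  by rewrite !inE !xpair_eqE; lia.
Qed.

Lemma sum3 (f : 'I_3 -> nat) :
  (\sum_(i < 3) f i = f (inord 0) + f (inord 1) + f (inord 2))%N.
Proof.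
rewrite !big_ord_recr big_ord0 /= add0n.
by congr (f _ + f _ + f _)%N; apply: val_inj; rewrite /= inordK.
Qed.

Lemma esym2_digit_sum k (m : 'X_{1..3}) :
  (esym2 ^+ (3 ^ k - 1))@_m != 0 -> (\sum_(i < 3) s3 k (m i) = 4 * k)%N.
Proof.
elim: k m => [|k IHk] m.
  by rewrite big1 // => i _; rewrite /s3 big_ord0.
rewrite mcoeff_esym2S mulf_eq0 expf_eq0 /= negb_or => /andP[/IHk sumk].
rewrite esym2_sqr_support; move: sumk; rewrite !sum3 !s3S !mnmE.
by rewrite !inE !xpair_eqE; lia.
Qed.

(** Digit by digit the triple is (2, t, 2 - t) up to a cyclic shift, which lies
    in the support of e ^ 2 for each t in {0, 1, 2}.  The indices i + 1 and
    i + 1 + 1 are taken modulo 3. *)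
Lemma esym2_compl_support k (m : 'X_{1..3}) (i : 'I_3) (v : nat) :
    (v < 3 ^ k)%N -> m i = (3 ^ k - 1)%N -> m (i + 1) = v ->
    m (i + 1 + 1) = (3 ^ k - v.+1)%N ->
  (esym2 ^+ (3 ^ k - 1))@_m != 0.
Proof.
have i01 : inord 0 + 1 = inord 1 :> 'I_3 by apply: val_inj; rewrite /= !inordK.
have i12 : inord 1 + 1 = inord 2 :> 'I_3 by apply: val_inj; rewrite /= !inordK.
have i20 : inord 2 + 1 = inord 0 :> 'I_3 by apply: val_inj; rewrite /= !inordK.
elim: k m v => [|k IHk] m v v_lt mi mi1 mi2.
  have m0 : m = 0%MM.
    have v0 : v = 0%N by lia.
    rewrite v0 in mi1 mi2.
    apply/mnmP => j; rewrite mnm0E; move: i j mi mi1 mi2.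
    by do 2!(apply: ord3_ind); rewrite ?(i01, i12, i20) => mi mi1 mi2;
      rewrite (mi, mi1, mi2).
  by rewrite m0 expr0 mcoeff1 eqxx oner_eq0.
rewrite expnS in v_lt mi mi2.
have q_gt0 := expn_gt0 3 k.
rewrite mcoeff_esym2S mulf_neq0 ?expf_neq0 //.
  by apply: (IHk _ (v %/ 3)%N); rewrite ?mnmE; lia.
have {mi} := congr1 (modn^~ 3) mi; have {mi1} := congr1 (modn^~ 3) mi1.
have {mi2} := congr1 (modn^~ 3) mi2; rewrite esym2_sqr_support !mnmE.
have -> : ((3 * 3 ^ k - 1) %% 3 = 2)%N by lia.
have -> : ((3 * 3 ^ k - v.+1) %% 3 = 2 - v %% 3)%N by lia.
have : (v %% 3 < 3)%N by rewrite ltn_mod.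
move: (v %% 3)%N => [|[|[|//]]] _; move: {IHk} i;
  by apply: ord3_ind; rewrite ?(i01, i12, i20) => -> -> ->.
Qed.

Lemma mcoeff_tau q (m : 'X_{1..3}) :
  (Tau.tau F q)@_m = (m == 0%MM)%:R - (esym2 ^+ (q - 1))@_m.
Proof. by rewrite /Tau.tau mcoeffB mcoeff1. Qed.

Lemma Gamma_zero k (g : triple (3 ^ k)) :
  (0 < k)%N -> (forall i, g i = 0 :> nat) -> g \in Gamma F (3 ^ k).
Proof.
move=> k_gt0 g0; rewrite inE mcoeff_tau.
have -> : [multinom (g i : nat) | i < 3] = 0%MM.
  by apply/mnmP => i; rewrite mnmE g0 mnm0E.
have [->|/esym2_digit_sum] := eqVneq ((esym2 ^+ (3 ^ k - 1))@_0) 0.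
  by rewrite eqxx subr0 oner_eq0.
by rewrite big1 => [|i _]; [lia | rewrite mnm0E s3_0].
Qed.

Lemma Gamma_digit_sum k (g : triple (3 ^ k)) : g \in Gamma F (3 ^ k) ->
  (forall i, g i = 0 :> nat) \/ (\sum_(i < 3) s3 k (g i) = 4 * k)%N.
Proof.
rewrite inE mcoeff_tau; set m := [multinom _ | _ < _].
have mE i : m i = g i by rewrite mnmE.
have [m0 _|m0] := eqVneq m 0%MM; first by left=> i; rewrite -mE m0 mnm0E.
rewrite sub0r oppr_eq0 => /esym2_digit_sum <-; right.
by apply: eq_bigr => i _; rewrite mE.
Qed.

Lemma Gamma_compl k (g : triple (3 ^ k)) (i : 'I_3) : (0 < k)%N ->
    g i = (3 ^ k - 1)%N :> nat -> g (i + 1 + 1) = rev_ord (g (i + 1)) ->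
  g \in Gamma F (3 ^ k).
Proof.
move=> k_gt0 gi gi2; rewrite inE mcoeff_tau; set m := [multinom _ | _ < _].
have mE j : m j = g j by rewrite mnmE.
have -> : (m == 0%MM) = false.
  apply/eqP => m0; have := mE i; rewrite gi m0 mnm0E.
  by have := ltn_expl k (isT : 1 < 3)%N; lia.
rewrite sub0r oppr_eq0.
by apply: (@esym2_compl_support _ _ i (g (i + 1))); rewrite ?mE // gi2.
Qed.

End Gamma.
End Support.

(** * The weight function *)

Section WeightFunction.
Variables (R : realType) (k : nat).
Hypothesis k_ge2 : (2 <= k)%N.
Let q := (3 ^ k)%N.

Let k_gt0 : (0 < k)%N. Proof. exact: ltnW. Qed.

Let q_gt0 : (0 < q)%N. Proof. by rewrite /q expn_gt0. Qed.

(** The second bound is what keeps w_q above -1 at digit sum 1. *)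
Lemma pow3_ge : (9 <= q)%N /\ (8 * k <= 3 * q)%N.
Proof.
rewrite /q; move: k_ge2; case: k => [|[|k']] // _.
elim: k' => [|k' [IH1 IH2]] //.
by rewrite expnS; lia.
Qed.

Let q_ge9 : 9 <= q%:R :> R. Proof. by rewrite (ler_nat _ 9); case: pow3_ge. Qed.

Let den_gt0 : 0 < 3 * q%:R - 4 :> R. Proof. by move: q_ge9; lra. Qed.

Let kR_gt0 : 0 < k%:R :> R. Proof. by rewrite ltr0n. Qed.

Lemma dq_gt0 : 0 < dq R q.
Proof. by rewrite /dq divr_gt0 //; move: q_ge9; lra. Qed.

Lemma dq_lt1 : dq R q < 1.
Proof. by rewrite /dq ltr_pdivrMr //; move: q_ge9; lra. Qed.

(** The formula defining w_q off zero, as a function of the digit sum s. *)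
Definition affine_weight (s : nat) : R :=
  3 * q%:R / (k%:R * (3 * q%:R - 4)) * s%:R - (3 * q%:R + 4) / (3 * q%:R - 4).

Lemma affine_weight_le s t :
  (s <= t)%N -> affine_weight s <= affine_weight t.
Proof.
move=> st; rewrite lerD2r ler_pM2l ?ler_nat // divr_gt0 ?mulr_gt0 //.
by rewrite ltr0n.
Qed.

Lemma affine_weight_max : affine_weight k.*2 = 1.
Proof.
rewrite /affine_weight -muln2 natrM; field.
by rewrite !gt_eqF // mulr_gt0.
Qed.

Lemma affine_weight1 : -1 <= affine_weight 1.
Proof.
have [_] := pow3_ge; rewrite -(ler_nat R) !natrM => kq.
have -> : affine_weight 1 =
    -1 + (3 * q%:R - 8 * k%:R) / (k%:R * (3 * q%:R - 4)).
  by rewrite /affine_weight; field; rewrite !gt_eqF // mulr_gt0.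
by rewrite lerDl divr_ge0 ?subr_ge0 // ltW // mulr_gt0.
Qed.

(** This makes w_q amenable to the affine computation even on elements of
    Gamma_q that have some zero coordinates, such as (0, q - 1, q - 1). *)
Lemma affine_weight_le_wq (a : 'I_q) : affine_weight (s3 k a) <= wq R k a.
Proof.
rewrite /wq; case: eqP => // ->; rewrite s3_0 /affine_weight mulr0 add0r /dq.
by rewrite -mulNr ler_pM2r ?invr_gt0 //; move: q_ge9; lra.
Qed.

Lemma wq_itv (a : 'I_q) : -1 <= wq R k a <= 1.
Proof.
rewrite /wq; case: eqP => [_|a0].
  by move: dq_gt0 dq_lt1; lra.
have s_le : (s3 k a <= k.*2)%N by rewrite -(s3_compl (ltn_ord a)) leq_addr.
have s_ge : (0 < s3 k a)%N.
  by apply: s3_gt0; rewrite ltn_ord lt0n andbT; exact/eqP.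
rewrite -/(affine_weight _) (le_trans affine_weight1) ?affine_weight_le //.
by rewrite -affine_weight_max affine_weight_le.
Qed.

Lemma sum_wq : \sum_(a < q) wq R k a = 0.
Proof.
pose a0 := Ordinal q_gt0.
have -> : \sum_(a < q) wq R k a =
    \sum_(a < q) affine_weight (s3 k a) + (dq R q - affine_weight 0).
  rewrite (bigD1 a0) //= [in RHS](bigD1 a0) //= {1}/wq eqxx /= s3_0.
  rewrite (eq_bigr (fun a : 'I_q => affine_weight (s3 k a))); last first.
    by move=> a /negPf; rewrite -val_eqE /wq /= => ->.
  by ring.
rewrite /affine_weight sumrB -mulr_sumr sumr_const card_ord -natr_sum sum_s3.
rewrite -mulr_natr natrM -/q /dq; field.
by rewrite !gt_eqF // mulr_gt0.
Qed.

Lemma sup_norm_wq : sup_norm (wq R k (q := q)) = 1.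
Proof.
apply/le_anti/andP; split.
  by apply: bigmax_le => // a _; rewrite ler_norml wq_itv.
have qp : (q - 1 < q)%N by rewrite subn1 ltn_predL.
apply: (le_trans _ (le_bigmax _ _ (Ordinal qp))).
rewrite /wq /= ifN; last by case: pow3_ge; lia.
by rewrite s3_max -/(affine_weight _) affine_weight_max normr1.
Qed.

Lemma wq_digit_sum (g : triple q) :
  (forall i, g i = 0 :> nat) \/ (\sum_(i < 3) s3 k (g i) = 4 * k)%N ->
  3 * dq R q <= \sum_(i < 3) wq R k (g i).
Proof.
case=> [g0|gk].
  under eq_bigr => i _ do rewrite /wq g0 /=.
  by rewrite sumr_const card_ord mulr_natl.
have -> : 3 * dq R q = \sum_(i < 3) affine_weight (s3 k (g i)).
  rewrite /affine_weight sumrB -mulr_sumr sumr_const card_ord -natr_sum gk.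
  by rewrite natrM /dq; field; rewrite !gt_eqF // mulr_gt0.
by apply: ler_sum => i _; exact: affine_weight_le_wq.
Qed.

End WeightFunction.

(** * Optimality of the ratio *)

Section Optimality.
Variables (R : realType) (q : nat).
Hypothesis q_ge4 : (4 <= q)%N.

Let q_gt0 : (0 < q)%N. Proof. exact: leq_trans q_ge4. Qed.

Let a0 : 'I_q := Ordinal q_gt0.

Let top : 'I_q := rev_ord a0.

Definition compl_triple (i : 'I_3) (v : 'I_q) : triple q :=
  [ffun j => if j == i then top else if j == i + 1 then v else rev_ord v].

Lemma sum_cycle (f : 'I_3 -> R) (i : 'I_3) :
  \sum_j f j = f i + f (i + 1) + f (i + 1 + 1).
Proof.
rewrite (reindex_inj (addrI i)) /= !big_ord_recl big_ord0 !addr0 -[RHS]addrA.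
by congr (_ + (f _ + f _)); apply: val_inj; case: i => [[|[|[|]]]].
Qed.

(** The linear programming dual: the weights 2 on (0, 0, 0) and 1 on each
    cyclic triple with v different from 0 and q - 1.  The two excluded values
    must be left out, since at the triple (q - 1, 0, q - 1) and its cyclic
    shifts the constraint is slack for w_q. *)
Lemma eta_le_sup_norm (w : 'I_3 -> 'I_q -> R) (eta : R) :
    (forall i, \sum_(a < q) w i a = 0) ->
    eta <= \sum_i w i a0 ->
    (forall i v, eta <= \sum_j w j (compl_triple i v j)) ->
  (3 * q%:R - 4) * eta <= (q%:R - 4) * \sum_i sup_norm (w i).
Proof.
move=> w0 eta_a0 eta_g.
have gE i v : \sum_j w j (compl_triple i v j) =
    w i top + w (i + 1) v + w (i + 1 + 1) (rev_ord v).
  rewrite (sum_cycle _ i) !ffunE !eqxx.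
  by case: i => [[|[|[|]]]].
set T := \sum_i w i top; set Z := \sum_i w i a0 in eta_a0.
have shift (f : 'I_3 -> R) : \sum_i f (i + 1) = \sum_i f i.
  by rewrite [RHS](reindex_inj (addIr 1)).
(* f v is the total slack of the three cyclic triples attached to v. *)
pose f v := T + \sum_i w i v + \sum_i w i (rev_ord v) - eta *+ 3.
have f_ge0 v : 0 <= f v.
  rewrite subr_ge0.
  have -> : eta *+ 3 = \sum_(i < 3) eta by rewrite sumr_const card_ord.
  apply: (le_trans (ler_sum _ (fun i _ => eta_g i v))).
  under eq_bigr => i _ do rewrite gE.
  rewrite !big_split /= (shift (w^~ v)).
  by rewrite (shift (fun i => w (i + 1) (rev_ord v))) (shift (w^~ (rev_ord v))).
have sum0 : \sum_v \sum_i w i v = 0 :> R.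
  by rewrite exchange_big /= big1.
have sum0r : \sum_v \sum_i w i (rev_ord v) = 0 :> R.
  by rewrite -[RHS]sum0 [RHS](reindex_inj rev_ord_inj).
have sumc (c : R) : \sum_(v < q) c = q%:R * c.
  by rewrite sumr_const card_ord mulr_natl.
have sumf : \sum_v f v = q%:R * T - q%:R * (eta *+ 3).
  rewrite /f sumrB !big_split /= sum0 sum0r.
  by rewrite !sumc; ring.
have revtop : rev_ord top = a0 by rewrite /top rev_ordK.
have topa0 : top != a0 by rewrite -val_eqE /= ; lia.
have : 0 <= \sum_(v | (v != a0) && (v != top)) f v by apply: sumr_ge0.
move: sumf; rewrite (bigD1 a0) //= (bigD1 top) //=.
move: (\sum_(v | _) f v) => S sumf S_ge0.
have fa0 : f a0 = T + Z + T - eta *+ 3 by [].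
have ftop : f top = T + T + Z - eta *+ 3 by rewrite /f revtop.
have TW : T <= \sum_i sup_norm (w i).
  apply: ler_sum => i _; apply: le_trans (ler_norm _) _.
  exact: (le_bigmax _ _ top).
have q4 : 0 <= q%:R - 4 :> R by rewrite subr_ge0 (ler_nat _ 4).
apply: le_trans (ler_wpM2l q4 TW).
move: sumf; rewrite fa0 ftop.
clear -eta_a0 S_ge0; clearbody T Z; move=> sumf.
have SE : S = q%:R * T - q%:R * (eta *+ 3) - (T *+ 4 + Z *+ 2 - eta *+ 6).
  by rewrite -sumf; ring.
have -> : (q%:R - 4) * T = (3 * q%:R - 4) * eta + (S + (Z - eta) *+ 2).
  by rewrite SE; ring.
by rewrite lerDl addr_ge0 // mulrn_wge0 // subr_ge0.
Qed.

End Optimality.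

(** * Entropy of a biased distribution *)

From mathcomp Require Import unstable interval_inference topology normedtype.
From mathcomp Require Import convex.
Import numFieldNormedType.Exports.

Section Hoeffding.
Variable R : realType.

Lemma fact_double_ge n : (2 ^ n * n`! <= n.*2`!)%N.
Proof.
elim: n => [|n IHn]; first by rewrite fact0.
rewrite doubleS !factS expnS.
by have := fact_gt0 n; nia.
Qed.

(** Comparison of the even terms of the power series: (2 m)! >= 2 ^ m m!. *)
Lemma exp_coeff_sym_le (t : R) m :
  exp_coeff t m.*2 + exp_coeff (- t) m.*2 <= 2 * exp_coeff (t ^+ 2 / 2) m.
Proof.
rewrite /exp_coeff /= exprNn -signr_odd odd_double expr0 mul1r.
rewrite -mulr2n -[leLHS]mulr_natl ler_pM2l //.
rewrite -mul2n exprM expr_div_n -mulrA mul2n.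
apply: ler_wpM2l; first by rewrite exprn_ge0 ?sqr_ge0.
rewrite -invfM.
rewrite lef_pV2 ?posrE ?mulr_gt0 ?exprn_gt0 ?ltr0n ?fact_gt0 //.
by rewrite -natrX -natrM ler_nat fact_double_ge.
Qed.

(** The inequality cosh t <= exp (t ^ 2 / 2), term by term on power series.  The
    odd terms of the left-hand side cancel, so its n first terms are bounded by
    the uphalf n first terms on the right. *)
Lemma cosh_le (t : R) : expR t + expR (- t) <= 2 * expR (t ^+ 2 / 2).
Proof.
have partial n : series (exp_coeff t) n + series (exp_coeff (- t)) n
    <= 2 * series (exp_coeff (t ^+ 2 / 2)) (uphalf n).
  elim: n => [|n IHn]; first by rewrite /series /= !big_geq // mulr0 addr0.
  rewrite 2!seriesSr addrACA; have [n_odd|n_even] := boolP (odd n).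
    have -> : uphalf n.+1 = uphalf n by lia.
    have -> : exp_coeff t n + exp_coeff (- t) n = 0.
      by rewrite /exp_coeff /= exprNn -signr_odd n_odd expr1 mulN1r mulNr subrr.
    by rewrite addr0.
  have nE : n = n./2.*2 by rewrite even_halfK.
  have -> : uphalf n.+1 = (uphalf n).+1 by lia.
  rewrite seriesSr mulrDr lerD //.
  have -> : uphalf n = n./2 by lia.
  by rewrite {1 2}nE exp_coeff_sym_le.
have cv (x : R) := is_cvg_series_exp_coeff x.
rewrite /expR -limD //; apply: limr_le; first exact: is_cvgD.
apply: nearW => n; apply: le_trans (partial n) _.
rewrite ler_pM2l //; apply: nondecreasing_cvgn_le => // i j ij.
apply: nondecreasing_series => // l _ _; apply: exp_coeff_ge0.
by rewrite divr_ge0 ?sqr_ge0.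
Qed.

Lemma expR_chord (t x : R) : -1 <= x <= 1 ->
  expR (t * x) <= (1 + x) / 2 * expR t + (1 - x) / 2 * expR (- t).
Proof.
move=> /andP[x_ge x_le].
have s_ge0 : 0 <= (1 + x) / 2 by lra.
have s_le1 : (1 + x) / 2 <= 1 by lra.
have := convex_expR (Itv01 s_ge0 s_le1) t (- t); rewrite !convRE /= /onem.
have -> : (1 + x) / 2 * t + (1 - (1 + x) / 2) * - t = t * x by field.
by have -> : 1 - (1 + x) / 2 = (1 - x) / 2 by field.
Qed.

(** Hoeffding's lemma for the uniform distribution: bound the exponential by its
    chord on [-1, 1]; the linear part averages to zero. *)
Lemma hoeffding (T : finType) (w : T -> R) (t : R) :
    (forall a, -1 <= w a <= 1) -> \sum_a w a = 0 ->
  \sum_a expR (t * w a) <= #|T|%:R * expR (t ^+ 2 / 2).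
Proof.
move=> w_itv w0.
apply: le_trans (ler_sum _ (fun a _ => expR_chord t (w_itv a))) _.
have -> : \sum_a ((1 + w a) / 2 * expR t + (1 - w a) / 2 * expR (- t)) =
    #|T|%:R * ((expR t + expR (- t)) / 2).
  rewrite big_split /= -!mulr_suml !big_split /= sumrN w0 sumr_const.
  by rewrite oppr0 !addr0 -mulrDr -!mulrA [2^-1 * _]mulrC.
by rewrite ler_wpM2l ?ler0n // ler_pdivrMr // [leRHS]mulrC cosh_le.
Qed.

(** Young's inequality for the conjugate pair p ln p - p and exp y. *)
Lemma entropy_term_le (p y : R) :
  0 <= p -> - (p * ln p) + p * y <= expR y - p.
Proof.
rewrite le_eqVlt => /predU1P[<-|p_gt0].
  by rewrite !mul0r oppr0 !addr0 expR_ge0.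
have := expR_ge1Dx (y - ln p); rewrite expRD expRN lnK ?posrE //.
rewrite ler_pdivlMr //; lra.
Qed.

(** Comparing p with the Gibbs distribution proportional to exp (t w) bounds its
    entropy by the logarithm of the partition function minus t times the mean
    of w.  Hoeffding's lemma bounds the former by ln |T| + t ^ 2 / 2, and
    t = d makes t ^ 2 / 2 - t d least. *)
Lemma entropy_le_bias (T : finType) (p w : T -> R) (d : R) :
    (forall a, 0 <= p a) -> \sum_a p a = 1 ->
    (forall a, -1 <= w a <= 1) -> \sum_a w a = 0 ->
    0 <= d <= \sum_a p a * w a ->
  entropy p <= ln #|T|%:R - d ^+ 2 / 2.
Proof.
move=> p_ge0 p1 w_itv w0 /andP[d_ge0 d_le].
have T_gt0 : 0 < #|T|%:R :> R.
  rewrite ltr0n lt0n; apply/eqP => T0; move: p1.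
  rewrite big1 => [/esym/eqP|a _]; first by rewrite oner_eq0.
  by have := card0_eq T0 a; rewrite inE.
(* L bounds the logarithm of the partition function at t = d. *)
pose L : R := ln #|T|%:R + d ^+ 2 / 2.
have term : entropy p + \sum_a p a * (d * w a - L) <=
    \sum_a expR (d * w a - L) - 1.
  rewrite /entropy -sumrN -[X in _ - X]p1 -sumrB -big_split /=.
  by apply: ler_sum => a _; exact: entropy_term_le.
have Z_le1 : \sum_a expR (d * w a - L) <= 1.
  under eq_bigr => a _ do rewrite expRD expRN.
  rewrite -mulr_suml /L expRD lnK ?posrE // ler_pdivrMr ?mulr_gt0 ?expR_gt0 //.
  by rewrite mul1r hoeffding.
have pw : \sum_a p a * (d * w a - L) = d * (\sum_a p a * w a) - L.
  under eq_bigr => a _ do rewrite mulrBr mulrCA.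
  by rewrite sumrB -mulr_sumr -mulr_suml p1 mul1r.
have dd : d ^+ 2 <= d * \sum_a p a * w a by rewrite expr2 ler_wpM2l.
by move: term; rewrite pw /L; lra.
Qed.

End Hoeffding.

(** * Entropy of the set, and the main result *)

Section SetEntropy.
Variables (R : realType) (q : nat).

Lemma sum_marginal (mu : triple q -> R) (i : 'I_3) (f : 'I_q -> R) :
  \sum_a marginal mu i a * f a = \sum_g mu g * f (g i).
Proof.
rewrite [RHS](partition_big (fun g : triple q => g i) predT) //=.
apply: eq_bigr => a _; rewrite mulr_suml.
by apply: eq_bigr => g /eqP ->.
Qed.

Lemma min_entropy_le (mu : triple q -> R) (i : 'I_3) :
  min_entropy mu <= entropy (marginal mu i).
Proof. exact: bigmin_le. Qed.

(** The mean of w summed over the three coordinates is at least 3 d, so one of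
    the three marginals has bias at least d.  The point g0 only serves to show
    that some distribution on A exists, so that the supremum is taken over a
    nonempty set. *)
Lemma set_entropy_le (A : {set triple q}) g0 (w : 'I_q -> R) (d : R) :
    g0 \in A -> 0 <= d ->
    (forall a, -1 <= w a <= 1) -> \sum_a w a = 0 ->
    (forall g, g \in A -> 3 * d <= \sum_i w (g i)) ->
  set_entropy R A <= ln q%:R - d ^+ 2 / 2.
Proof.
move=> g0A d_ge0 w_itv w0 w_ge; apply: ge_sup.
  exists (min_entropy (fun g => (g == g0)%:R)), (fun g => (g == g0)%:R) => //.
  split=> [g|g gA|]; first exact: ler0n.
    by rewrite (_ : (g == g0) = false) //; apply: contraNF gA => /eqP ->.
  by rewrite (bigD1 g0) //= eqxx big1 ?addr0 // => g /negPf ->.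
move=> _ [mu [mu_ge0 mu_out mu1] <-].
have avg : \sum_(i < 3) d <= \sum_(i < 3) \sum_a marginal mu i a * w a.
  under [leRHS]eq_bigr => i _ do rewrite sum_marginal.
  rewrite exchange_big sumr_const card_ord -mulr_natl.
  rewrite -[leLHS]mul1r -[X in X * _ <= _]mu1 mulr_suml.
  apply: ler_sum => g _; rewrite -mulr_sumr.
  have [gA|gA] := boolP (g \in A); first by rewrite ler_wpM2l ?w_ge.
  by rewrite mu_out // !mul0r.
have [i d_le] : exists i : 'I_3, d <= \sum_a marginal mu i a * w a.
  apply/existsP; apply: contraLR avg.
  rewrite negb_exists -ltNge => /forallP d_gt.
  apply: ltr_sum => [|i _]; last by rewrite ltNge.
  by apply/hasP; exists ord0; rewrite ?mem_index_enum.
apply: le_trans (min_entropy_le mu i) _.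
rewrite -[q in q%:R]card_ord; apply: (entropy_le_bias (w := w)) => //.
- by move=> a; apply: sumr_ge0.
- rewrite -mu1 -[RHS](eq_bigr _ (fun g _ => mulr1 (mu g))).
  rewrite -(sum_marginal mu i (fun=> 1)).
  by apply: eq_bigr => a _; rewrite mulr1.
- by rewrite d_ge0.
Qed.

End SetEntropy.

Theorem proposition3p3 (R : realType) (k q : nat) (F : finFieldType)
    (k_ge2 : (2 <= k)%N) (q_def : q = (3 ^ k)%N) (card_F : #|F| = q) :
  [/\ \sum_(a < q) wq R k a = 0,
      sup_norm (wq R k (q := q)) = 1
    & forall g : triple q, g \in Gamma F q ->
        \sum_(i < 3) wq R k (g i) >= 3 * dq R q]
  /\ (forall (w : 'I_3 -> 'I_q -> R) (eta : R),
        0 < eta ->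
        (forall i, \sum_(a < q) w i a = 0) ->
        (forall g : triple q, g \in Gamma F q ->
           \sum_(i < 3) w i (g i) >= eta) ->
        eta / (\sum_(i < 3) sup_norm (w i)) <= dq R q)
  /\ [/\ set_entropy R (Gamma F q) <= ln q%:R - dq R q ^+ 2 / 2,
         expR (set_entropy R (Gamma F q)) <= q%:R * expR (- (dq R q ^+ 2 / 2))
       & q%:R * expR (- (dq R q ^+ 2 / 2)) < q%:R :> R].
Proof.
subst q.
have char3 : 3%N \in [pchar F] by exact: card_finPcharP card_F _.
have k_gt0 : (0 < k)%N by exact: ltnW.
have q_ge9 : (9 <= 3 ^ k)%N by case: (pow3_ge k_ge2).
have q_gt0 : (0 < 3 ^ k)%N by exact: leq_trans q_ge9.
have qR_gt0 : 0 < (3 ^ k)%:R :> R by rewrite ltr0n.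
have d_gt0 : 0 < dq R (3 ^ k) by exact: dq_gt0.
have w_ge g : g \in Gamma F (3 ^ k) ->
    3 * dq R (3 ^ k) <= \sum_(i < 3) wq R k (g i).
  by move=> gG; apply: wq_digit_sum => //; apply: Support.Gamma_digit_sum gG.
have G0 : [ffun=> Ordinal q_gt0] \in Gamma F (3 ^ k).
  by apply: Support.Gamma_zero => // i; rewrite ffunE.
have H_le : set_entropy R (Gamma F (3 ^ k)) <=
    ln (3 ^ k)%:R - dq R (3 ^ k) ^+ 2 / 2.
  apply: (set_entropy_le (w := wq R k (q := 3 ^ k)) G0) => //.
  - exact: ltW.
  - exact: wq_itv.
  - exact: sum_wq.
split; first by split; [exact: sum_wq | exact: sup_norm_wq | ].
split; last first.
  split=> //.
    by rewrite -[X in X * _](lnK qR_gt0) -expRD ler_expR.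
  by rewrite gtr_pMr // expR_lt1 oppr_lt0 divr_gt0 ?exprn_gt0.
move=> w eta eta_gt0 w0 w_eta.
have q_ge4 : (4 <= 3 ^ k)%N by exact: leq_trans q_ge9.
have key : (3 * (3 ^ k)%:R - 4) * eta <=
    ((3 ^ k)%:R - 4) * \sum_i sup_norm (w i).
  apply: (eta_le_sup_norm (q_ge4 := q_ge4) w0) => [|i v].
    have := w_eta _ G0; under eq_bigr => i _ do rewrite ffunE.
    by congr (_ <= _); apply: eq_bigr => i _; congr (w i _); apply: val_inj.
  apply: w_eta; apply: (Support.Gamma_compl char3 (i := i) k_gt0).
    by rewrite ffunE eqxx /= ; lia.
  by rewrite !ffunE; case: i => [[|[|[|]]]].
have den_gt0 : 0 < 3 * (3 ^ k)%:R - 4 :> R.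
  by rewrite subr_gt0 -(natrM _ 3) (ltr_nat _ 4); lia.
have W_ge0 : 0 <= \sum_(i < 3) sup_norm (w i).
  by apply: sumr_ge0 => i _; exact: bigmax_ge_id.
have [->|W_neq0] := eqVneq (\sum_(i < 3) sup_norm (w i)) 0.
  by rewrite invr0 mulr0 ltW.
rewrite ler_pdivrMr ?lt_def ?W_neq0 // /dq mulrAC ler_pdivlMr //.
by rewrite mulrC.
Qed.
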